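(* Let $\mu>0$ and let $\mathbf{x}^*(\mu)$ be the solution of the generalised Tikhonov least squares problem with data $\mathbf{b}\in\mathbb{R}^n$ and $\mathbf{v}=(\mathbf{v}_1^T,\ldots,\mathbf{v}_s^T)^T$, $\mathbf{v}_j\in\mathbb{R}^N$, given by the expression $$\mathbf{x}^*(\mu)=\mathbf{F}^H\Big[\mathbf{\Psi}-\mu\mathbf{\Psi}\underline{\mathbf{\Lambda}}^H\big(d\mathbf{I}_n+\mu\underline{\mathbf{\Lambda}}\mathbf{\Psi}\underline{\mathbf{\Lambda}}^H\big)^{-1}\underline{\mathbf{\Lambda}}\mathbf{\Psi}\Big]\Big(\mu\mathbf{\Lambda}^H\tilde{\mathbf{b}}_H+\sum_{j=1}^s\mathbf{\Gamma}_j^H\tilde{\mathbf{v}}_j\Big).$$ Let $\mathbf{r}^*(\mu)=\mathbf{S}\mathbf{K}\mathbf{x}^*(\mu)-\mathbf{b}$, assumed nonzero, and let $W(\mu)=\|\mathbf{r}^*(\mu)\star\mathbf{r}^*(\mu)\|_2^2/\|\mathbf{r}^*(\mu)\|_2^4$ be the residual whiteness function. Then the residual whiteness function takes the form $$W(\mu)=\left(\sum_{i=1}^N\left|\frac{\nu_i-\varrho_i}{1+\eta_i\mu}\right|^4\right)\Big/\left(\sum_{i=1}^N\left|\frac{\nu_i-\varrho_i}{1+\eta_i\mu}\right|^2\right)^2,$$ where, for $i=1,\ldots,N$ and $\iota:=1+\lfloor (i-1)/d\rfloor d$, the parameters $\eta_i\in\mathbb{R}_+$, $\varrho_i\in\mathbb{C}$,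 $\nu_i\in\mathbb{C}$ are $$\eta_i:=\frac1d\sum_{\ell=0}^{d-1}\frac{|\hat\lambda_{\iota+\ell}|^2}{\zeta_{\iota+\ell}+\epsilon},\qquad \varrho_i:=\sum_{\ell=0}^{d-1}\hat b_{H,\iota+\ell},\qquad \nu_i:=\sum_{\ell=0}^{d-1}\frac{\hat\lambda_{\iota+\ell}\sum_{j=1}^s\overline{\hat\gamma_{j,\iota+\ell}}\,\hat v_{j,\iota+\ell}}{\zeta_{\iota+\ell}+\epsilon},\qquad \zeta_{k}:=\sum_{j=1}^s|\hat\gamma_{j,k}|^2 .$$
   Context: Sizes: $n_r,n_c,d_r,d_c,s$ are positive integers, $N_r=n_rd_r$, $N_c=n_cd_c$, $n=n_rn_c$, $d=d_rd_c$, $N=N_rN_c=nd$. Images of size $N_r\times N_c$ (resp. $n_r\times n_c$) are identified with vectors in $\mathbb{R}^N$ (resp. $\mathbb{R}^n$) by row-wise vectorisation. The generalised Tikhonov problem is $\min_{\mathbf{x}\in\mathbb{R}^N}\{\frac{\mu}{2}\|\mathbf{S}\mathbf{K}\mathbf{x}-\mathbf{b}\|_2^2+\frac12\|\mathbf{L}\mathbf{x}-\mathbf{v}\|_2^2\}$ with $\mathbf{L}=(\mathbf{L}_1^T,\ldots,\mathbf{L}_s^T)^T\in\mathbb{R}^{sN\times N}$; its solution is represented by the expression for $\mathbf{x}^*(\mu)$ in the claim, which contains a fixed parameter $0<\epsilon\ll1$ guaranteeing the inversion of $\sum_j\mathbf{\Gamma}_j^H\mathbf{\Gamma}_j$. In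 the claim $\mathbf{x}^*(\mu)$ means exactly that expression. $\mathbf{F}\in\mathbb{C}^{N\times N}$ is the 2D discrete Fourier transform matrix acting on vectorised $N_r\times N_c$ images, with $\mathbf{F}\mathbf{F}^H=\mathbf{F}^H\mathbf{F}=\mathbf{I}_N$. $\mathbf{K},\mathbf{L}_1,\ldots,\mathbf{L}_s\in\mathbb{R}^{N\times N}$ are matrices of 2D circular convolutions (periodic boundary conditions), so $\mathbf{K}=\mathbf{F}^H\mathbf{\Lambda}\mathbf{F}$ and $\mathbf{L}_j=\mathbf{F}^H\mathbf{\Gamma}_j\mathbf{F}$ with $\mathbf{\Lambda},\mathbf{\Gamma}_j\in\mathbb{C}^{N\times N}$ diagonal. $\mathbf{S}\in\mathbb{R}^{n\times N}$ is the binary decimation matrix keeping, from an $N_r\times N_c$ image with indices starting from $0$, the pixels $(id_r,jd_c)$, $0\le i<n_r$, $0\le j<n_c$ (in row-wise order); thus $\mathbf{S}\mathbf{S}^H=\mathbf{I}_n$ and $\mathbf{S}^H$ interpolates with zeros. $\mathbf{I}_m$ is the $m\times m$ identity matrix, $\mathbf{J}_m$ the $m\times m$ all-ones matrix, $\mathbf{1}_d\in\mathbb{R}^d$ the all-ones column vector, $\otimes$ the Kronecker product. $\mathbf{P}\in\mathbb{R}^{N\times N}$ is a permutation matrix such that $\mathbf{P}[(\mathbf{J}_{d_r}\otimes\mathbf{I}_{n_r})\otimes(\mathbf{J}_{d_c}\otimes\mathbf{I}_{n_c})]\mathbf{P}^T=\mathbf{I}_n\otimes\mathbf{J}_d$.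 Set $$\underline{\mathbf{\Lambda}}:=(\mathbf{I}_n\otimes\mathbf{1}_d^T)\mathbf{P}\mathbf{\Lambda},\qquad \underline{\mathbf{\Lambda}}^H:=\mathbf{\Lambda}^H\mathbf{P}^T(\mathbf{I}_n\otimes\mathbf{1}_d),\qquad \mathbf{\Psi}:=\Big(\sum_{j=1}^s\mathbf{\Gamma}_j^H\mathbf{\Gamma}_j+\epsilon\mathbf{I}_N\Big)^{-1}.$$ Further $\mathbf{b}_H:=\mathbf{S}^H\mathbf{b}\in\mathbb{R}^N$, $\tilde{\mathbf{b}}_H:=\mathbf{F}\mathbf{b}_H$, $\tilde{\mathbf{v}}_j:=\mathbf{F}\mathbf{v}_j$, $\hat{\mathbf{b}}_H:=\mathbf{P}\tilde{\mathbf{b}}_H$ with entries $\hat b_{H,k}$, $\hat{\mathbf{v}}_j:=\mathbf{P}\tilde{\mathbf{v}}_j$ with entries $\hat v_{j,k}$; $\hat\lambda_k$ and $\hat\gamma_{j,k}$ are the $k$-th diagonal entries of $\mathbf{P}\mathbf{\Lambda}\mathbf{P}^T$ and $\mathbf{P}\mathbf{\Gamma}_j\mathbf{P}^T$. A bar denotes complex conjugation. For an $n_r\times n_c$ image $\mathbf{e}$, $\mathbf{e}\star\mathbf{e}$ is its 2D circular auto-correlation, $(\mathbf{e}\star\mathbf{e})_{l,m}=\sum_{i=0}^{n_r-1}\sum_{j=0}^{n_c-1}e_{i,j}\,e_{i+l,j+m}$, $0\le l<n_r$, $0\le m<n_c$, indices modulo $n_r$ and $n_c$; $\|\cdot\|_2$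 is the Euclidean (Frobenius) norm.
   Formalization: The printed formula for W(μ) lacks a constant factor N and fails for N>1 (e.g. n_r=1, n_c=2, d=s=1, K=L=0, b=(1,0): W=1 but the right side is 1/2); the formal theorem states W(μ) = N · (Σ|·|^4)/(Σ|·|^2)^2. *)

(* Defs.v *)
From HB Require Import structures.
From mathcomp Require Import all_boot all_order all_algebra.
From mathcomp Require Import reals trigo.
From mathcomp Require Import complex mxtens.

Set Implicit Arguments.
Unset Strict Implicit.
Unset Printing Implicit Defensive.

Import Order.TTheory GRing.Theory Num.Theory.
Local Open Scope ring_scope.
Local Open Scope complex_scope.

(* Conventions.  All indices start from 0.  An image with Nr rows and Nc columns
   is the column vector of length Nr * Nc whose entry mxtens_index (p, q),
   that is p * Nc + q, is the pixel (p, q).  Large images have dr * nr rows and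
   dc * nc columns: the factors are in this order so that
   (J_dr (x) I_nr) (x) (J_dc (x) I_nc) has the type of the other N x N matrices.
   Only I_n (x) J_d and I_n (x) 1_d then require a cast. *)

Definition addm_ord (m : nat) (i j : 'I_m) : 'I_m :=
  Ordinal (ltn_pmod (i + j) (leq_ltn_trans (leq0n i) (ltn_ord i))).

Definition subm_ord (m : nat) (i j : 'I_m) : 'I_m :=
  Ordinal (ltn_pmod (i + (m - j)) (leq_ltn_trans (leq0n i) (ltn_ord i))).

Definition adjmx (R : realType) (m n : nat) (A : 'M[R[i]]_(m, n)) :
  'M[R[i]]_(n, m) := map_mx Num.conj (A^T).

Definition cmx (R : realType) (m n : nat) (A : 'M[R]_(m, n)) :
  'M[R[i]]_(m, n) := map_mx (real_complex R) A.

Definition image_of (T : Type) (nr nc : nat) (x : 'M[T]_(nr * nc, 1)) :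
  'M[T]_(nr, nc) := \matrix_(i, j) x (mxtens_index (i, j)) ord0.

(* The factor 1 / sqrt (Nr Nc) makes the transform unitary. *)
Definition dft2 (R : realType) (Nr Nc : nat) : 'M[R[i]]_(Nr * Nc) :=
  \matrix_(a, b)
    let k := (mxtens_unindex a).1 in let l := (mxtens_unindex a).2 in
    let p := (mxtens_unindex b).1 in let q := (mxtens_unindex b).2 in
    let theta : R :=
      - (2 * pi * ((k * p)%:R / Nr%:R + (l * q)%:R / Nc%:R)) in
    ((Num.sqrt (Nr * Nc)%:R)^-1)%:C * (cos theta +i* sin theta).

Definition conv2_mx (R : realType) (Nr Nc : nat) (h : 'M[R]_(Nr, Nc)) :
  'M[R]_(Nr * Nc) :=
  \matrix_(a, b)
    h (subm_ord (mxtens_unindex a).1 (mxtens_unindex b).1)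
      (subm_ord (mxtens_unindex a).2 (mxtens_unindex b).2).

Definition is_conv2 (R : realType) (Nr Nc : nat) (A : 'M[R]_(Nr * Nc)) : Prop :=
  exists h : 'M[R]_(Nr, Nc), A = conv2_mx h.

Definition decim_mx (R : realType) (nr nc dr dc : nat) :
  'M[R]_(nr * nc, dr * nr * (dc * nc)) :=
  \matrix_(a, b)
    (((mxtens_unindex b).1 == (mxtens_unindex a).1 * dr :> nat)%N &&
     ((mxtens_unindex b).2 == (mxtens_unindex a).2 * dc :> nat)%N)%:R.

Lemma block_size (nr nc dr dc : nat) :
  (nr * nc * (dr * dc) = dr * nr * (dc * nc))%N.
Proof. by rewrite mulnACA (mulnC nr) (mulnC nc). Qed.

Definition alias_mx (R : realType) (nr nc dr dc : nat) :
  'M[R]_(dr * nr * (dc * nc)) :=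
  ((const_mx 1 : 'M_dr) *t (1%:M : 'M_nr)) *t
  ((const_mx 1 : 'M_dc) *t (1%:M : 'M_nc)).

Definition block_ones_mx (R : realType) (nr nc dr dc : nat) :
  'M[R]_(dr * nr * (dc * nc)) :=
  castmx (block_size nr nc dr dc, block_size nr nc dr dc)
    ((1%:M : 'M_(nr * nc)) *t (const_mx 1 : 'M_(dr * dc))).

Definition block_ones_col (R : realType) (nr nc dr dc : nat) :
  'M[R]_(dr * nr * (dc * nc), nr * nc) :=
  castmx (block_size nr nc dr dc, muln1 (nr * nc))
    ((1%:M : 'M_(nr * nc)) *t (const_mx 1 : 'cV_(dr * dc))).

Definition uLam (R : realType) (nr nc dr dc : nat)
    (P : 'M[R]_(dr * nr * (dc * nc))) (Lam : 'M[R[i]]_(dr * nr * (dc * nc))) :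
  'M[R[i]]_(nr * nc, dr * nr * (dc * nc)) :=
  cmx (block_ones_col R nr nc dr dc)^T *m cmx P *m Lam.

Definition uLamH (R : realType) (nr nc dr dc : nat)
    (P : 'M[R]_(dr * nr * (dc * nc))) (Lam : 'M[R[i]]_(dr * nr * (dc * nc))) :
  'M[R[i]]_(dr * nr * (dc * nc), nr * nc) :=
  adjmx Lam *m cmx P^T *m cmx (block_ones_col R nr nc dr dc).

Definition Psi (R : realType) (N s : nat) (Gam : 'I_s -> 'M[R[i]]_N)
    (eps : R) : 'M[R[i]]_N :=
  invmx (\sum_j adjmx (Gam j) *m Gam j + (eps%:C)%:M).

Definition tikhonov_sol (R : realType) (nr nc dr dc s : nat)
    (P : 'M[R]_(dr * nr * (dc * nc))) (Lam : 'M[R[i]]_(dr * nr * (dc * nc)))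
    (Gam : 'I_s -> 'M[R[i]]_(dr * nr * (dc * nc)))
    (b : 'cV[R]_(nr * nc)) (v : 'I_s -> 'cV[R]_(dr * nr * (dc * nc)))
    (eps mu : R) : 'cV[R[i]]_(dr * nr * (dc * nc)) :=
  let F := dft2 R (dr * nr) (dc * nc) in
  let S := cmx (decim_mx R nr nc dr dc) in
  let U := uLam P Lam in
  let UH := uLamH P Lam in
  let Ps := Psi Gam eps in
  adjmx F *m
  (Ps - mu%:C *:
     (Ps *m UH *m
      invmx (((dr * dc)%:R)%:M + mu%:C *: (U *m Ps *m UH)) *m U *m Ps)) *m
  (mu%:C *: (adjmx Lam *m (F *m (adjmx S *m cmx b)))
   + \sum_j adjmx (Gam j) *m (F *m cmx (v j))).

Definition residual (R : realType) (nr nc dr dc : nat)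
    (K : 'M[R]_(dr * nr * (dc * nc))) (b : 'cV[R]_(nr * nc))
    (x : 'cV[R[i]]_(dr * nr * (dc * nc))) : 'cV[R[i]]_(nr * nc) :=
  cmx (decim_mx R nr nc dr dc) *m cmx K *m x - cmx b.

(* No conjugate: this is the auto-correlation of real images. It is stated over
   R[i] since the residual is given by an expression in complex matrices. *)
Definition autocorr (R : realType) (m n : nat) (e : 'M[R[i]]_(m, n)) :
  'M[R[i]]_(m, n) :=
  \matrix_(l, k) \sum_i \sum_j e i j * e (addm_ord i l) (addm_ord j k).

Definition frob (R : realType) (m n : nat) (e : 'M[R[i]]_(m, n)) : R :=
  Num.sqrt (\sum_i \sum_j Normc.normc (e i j) ^+ 2).

(* The unnormalised auto-correlation and the unitary DFT are related by
   F (e * e) = sqrt (m n) |F e|^2 entrywise, and F S^H r consists of d copies of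
   F r scaled by 1 / sqrt d. Hence, in terms of the entries c_i of F S^H r,
   whiteness = N * (\sum_i |c_i|^4) / (\sum_i |c_i|^2)^2 with N = m n d. *)
Definition whiteness (R : realType) (m n : nat) (e : 'M[R[i]]_(m, n)) : R :=
  frob (autocorr e) ^+ 2 / frob e ^+ 4.

Lemma block_idx_proof (nr nc dr dc : nat)
    (i : 'I_(dr * nr * (dc * nc))) (l : 'I_(dr * dc)) :
  (i %/ (dr * dc) * (dr * dc) + l < dr * nr * (dc * nc))%N.
Proof.
have d_gt0 : (0 < dr * dc)%N by apply: leq_ltn_trans (ltn_ord l).
have : (i %/ (dr * dc) < nr * nc)%N by rewrite ltn_divLR // [ltnRHS]block_size.
rewrite -ltnS => lt_i; apply: (@leq_trans (nr * nc * (dr * dc))).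
  apply: (@leq_trans ((i %/ (dr * dc)).+1 * (dr * dc))).
    by rewrite mulSnr ltn_add2l.
  by rewrite leq_mul2r -ltnS lt_i orbT.
by rewrite block_size.
Qed.

Definition block_idx (nr nc dr dc : nat)
    (i : 'I_(dr * nr * (dc * nc))) (l : 'I_(dr * dc)) :
  'I_(dr * nr * (dc * nc)) := Ordinal (block_idx_proof i l).

Definition hat_diag (R : realType) (N : nat) (P : 'M[R]_N) (D : 'M[R[i]]_N)
    (k : 'I_N) : R[i] := (cmx P *m D *m cmx P^T) k k.

Definition zeta_par (R : realType) (N s : nat) (gamh : 'I_s -> 'I_N -> R[i])
    (k : 'I_N) : R := \sum_j Normc.normc (gamh j k) ^+ 2.

Definition eta_par (R : realType) (nr nc dr dc s : nat) (eps : R)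
    (lamh : 'I_(dr * nr * (dc * nc)) -> R[i])
    (gamh : 'I_s -> 'I_(dr * nr * (dc * nc)) -> R[i])
    (i : 'I_(dr * nr * (dc * nc))) : R :=
  (dr * dc)%:R^-1 *
  \sum_(l < dr * dc) Normc.normc (lamh (block_idx i l)) ^+ 2
                     / (zeta_par gamh (block_idx i l) + eps).

Definition rho_par (R : realType) (nr nc dr dc : nat)
    (bh : 'cV[R[i]]_(dr * nr * (dc * nc)))
    (i : 'I_(dr * nr * (dc * nc))) : R[i] :=
  \sum_(l < dr * dc) bh (block_idx i l) ord0.

Definition nu_par (R : realType) (nr nc dr dc s : nat) (eps : R)
    (lamh : 'I_(dr * nr * (dc * nc)) -> R[i])
    (gamh : 'I_s -> 'I_(dr * nr * (dc * nc)) -> R[i])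
    (vh : 'I_s -> 'cV[R[i]]_(dr * nr * (dc * nc)))
    (i : 'I_(dr * nr * (dc * nc))) : R[i] :=
  \sum_(l < dr * dc)
    lamh (block_idx i l)
    * (\sum_j Num.conj (gamh j (block_idx i l)) * vh j (block_idx i l) ord0)
    / (zeta_par gamh (block_idx i l) + eps)%:C.

(* Main.v *)
Require Import Defs.
From HB Require Import structures.
From mathcomp Require Import all_boot all_order all_algebra.
From mathcomp Require Import fingroup perm.
From mathcomp Require Import reals trigo.
From mathcomp Require Import complex mxtens.
From mathcomp Require Import ring lra.
Import Order.TTheory GRing.Theory Num.Theory.
Local Open Scope ring_scope.
Local Open Scope complex_scope.

(** Let [F] be the large unitary DFT, [S] the decimation and [T = F S^H], the
    Fourier transform of images that are interpolated with zeros.  Everything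
    rests on two identities for [T]: [T^H T = 1], and [T T^H] is [1 / d] times
    the aliasing matrix, which the permutation [P] turns into [I_n (x) J_d].

    Residual.  Put [G = (I_n (x) 1_d^T) P], so that [U = G Lam] and
    [T T^H = G^H G / d].  Let [Psi] be the inverse penalty, [Q] the bracket in
    the formula for the solution and [D = d I + mu U Psi U^H].  The Woodbury
    computation gives [U Q = d D^-1 U Psi] ([woodbury_mull]).  From it,
    [P T r = (1 / d) (I_n (x) 1_d) X], where [D X = d (nu - rho)]
    ([sampled_residualE], [capacitance_residual]).  In the permuted basis [Lam],
    [Gam] and [Psi] are diagonal, so [U Psi U^H] only sums inside blocks of
    length [d]: [D] is diagonal with entries [d (1 + eta mu)]
    ([capacitanceE]).  Thus the entries of [P T r] are the announced quotients
    divided by [d], and this factor cancels in the whiteness ratio.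

    Whiteness.  As [T] is an isometry, [|r|^2] and [|T r|^2] agree.
    For real [r] the squared moduli of the entries of [T r] are, up to the factor
    [1 / sqrt N], the entries of [T] applied to the auto-correlation
    ([decdft_power_spectrum], an instance of [wiener_khinchin]).  Applying the
    isometry again, the squared norm of the auto-correlation is [N] times the sum
    of the fourth powers ([whiteness_decdft]).

    Realness of [r].  This is where the real matrices behind [Lam] and [Gam]
    enter: multiplied on the right by [F] and on the left by [F^H], the Woodbury
    identity says that the solution satisfies the normal equations of the least
    squares problem, a real invertible system ([tikhonov_normal_eq]). *)

(** * One-dimensional discrete Fourier transform and decimation *)

Section Fourier.
Set Implicit Arguments.
Unset Strict Implicit.
Context {R : realType}.
Local Notation C := R[i].

Definition cis (t : R) : C := cos t +i* sin t.

Lemma cisD s t : cis (s + t) = cis s * cis t.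
Proof. by rewrite /cis cosD sinD [sin s * _ + _]addrC. Qed.

Lemma cis0 : cis 0 = 1.
Proof. by rewrite /cis cos0 sin0. Qed.

Lemma cisMn t n : cis (t *+ n) = cis t ^+ n.
Proof. by elim: n => [|n IHn]; rewrite ?cis0 // mulrS cisD IHn exprS. Qed.

Lemma conj_cis t : Num.conj (cis t) = (cis t)^-1.
Proof.
have u : cis t * cis (- t) = 1 by rewrite -cisD subrr cis0.
have nz : cis t != 0 by apply: contra_eq_neq u => ->; rewrite mul0r eq_sym oner_eq0.
by apply: (mulfI nz); rewrite mulfV // -[RHS]u /cis cosN sinN.
Qed.

(** By [cos 2t = 1 - 2 (sin t)^2]; this is what makes [rootu m] primitive. *)
Lemma cis_eq1 t : 0 < t < pi -> cis (- (t *+ 2)) != 1.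
Proof.
move=> /sin_gt0_pi sin_gt0; rewrite /cis cosN cos_mulr2n cos2sin2.
rewrite eq_complex /= negb_and; apply/orP; left.
have : 0 < sin t ^+ 2 by rewrite exprn_gt0.
lra.
Qed.

Definition rootu (m : nat) : C := cis (- (2 * pi / m%:R)).

Lemma prim_rootu m : (0 < m)%N -> m.-primitive_root (rootu m).
Proof.
move=> m_gt0; have mR_gt0 : 0 < m%:R :> R by rewrite ltr0n.
apply/andP; split=> //; apply/forallP => -[j j_lt] /=.
rewrite unity_rootE -cisMn; case: (eqVneq j.+1 m) => [->|j_neq].
  rewrite mulNrn -[_ *+ m]mulr_natr mulfVK ?(gt_eqF mR_gt0) // mulr_natl.
  by rewrite /cis cosN sinN cos2pi sin2pi oppr0 !eqxx.
have {j_neq}j_lt : (j.+1 < m)%N by rewrite ltn_neqAle j_neq.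
suff -> : - (2 * pi / m%:R) *+ j.+1 = - ((pi * j.+1%:R / m%:R) *+ 2) :> R.
  rewrite (negPf (cis_eq1 _)) //.
  rewrite divr_gt0 ?mulr_gt0 ?pi_gt0 ?ltr0n //=.
  by rewrite ltr_pdivrMr // ltr_pM2l ?pi_gt0 // ltr_nat.
by rewrite -[LHS]mulr_natr -mulr_natl; ring.
Qed.

Lemma rootu_neq0 m : rootu m != 0.
Proof.
apply/eqP => w0; have := conj_cis (- (2 * pi / m%:R)); rewrite -/(rootu m) => H.
have : rootu m * cis (2 * pi / m%:R) = 1 by rewrite -cisD addNr cis0.
by rewrite w0 mul0r => /esym/eqP; rewrite oner_eq0.
Qed.

Lemma conj_rootuX m j : Num.conj (rootu m ^+ j) = (rootu m ^+ j)^-1.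
Proof. by rewrite rmorphXn /= conj_cis exprVn. Qed.

(** Orthogonality of characters: the summand is the [a]-th power of the ratio of
    two powers of the root, so this is a geometric sum, with ratio [1] exactly
    when [k] and [l] are congruent. *)
Lemma sum_char m (m_gt0 : (0 < m)%N) k l :
  \sum_(a < m) rootu m ^+ (k * a) * Num.conj (rootu m ^+ (l * a))
  = (m%:R) *+ (k == l %[mod m]).
Proof.
have prim := prim_rootu m_gt0; pose q := rootu m ^+ k / rootu m ^+ l.
rewrite (eq_bigr (fun a : 'I_m => q ^+ a)) => [|a _]; last first.
  by rewrite conj_rootuX !exprM -expr_div_n.
have q1 : (q == 1) = (k == l %[mod m]).
  rewrite -(eq_prim_root_expr prim) /q -subr_eq0 -[1](@mulfV _ (rootu m ^+ l)).
    by rewrite -mulrBl mulf_eq0 invr_eq0 expf_eq0 (negPf (rootu_neq0 m)) andbF orbF subr_eq0.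
  by rewrite expf_neq0 ?rootu_neq0.
case: (boolP (k == l %[mod m])) => kl.
  move: q1; rewrite kl => /eqP ->.
  by under eq_bigr do rewrite expr1n; rewrite sumr_const card_ord.
have : (q - 1) * (\sum_(a < m) q ^+ a) = 0.
  rewrite -subrX1 expr_div_n -!exprM !(mulnC _ m) !exprM (prim_expr_order prim).
  by rewrite !expr1n divr1 subrr.
by move/eqP; rewrite mulf_eq0 subr_eq0 q1 (negPf kl) /= => /eqP.
Qed.

Definition invsqrt (m : nat) : C := ((Num.sqrt m%:R)^-1)%:C.

Lemma conj_invsqrt m : Num.conj (invsqrt m) = invsqrt m.
Proof. exact: conjc_real. Qed.

Lemma invsqrt_sqr m : invsqrt m * invsqrt m = m%:R^-1.
Proof.
rewrite /invsqrt -rmorphM -invfM -expr2 sqr_sqrtr ?ler0n //.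
by rewrite fmorphV rmorph_nat.
Qed.

Lemma invsqrtM m n : invsqrt (m * n) = invsqrt m * invsqrt n.
Proof. by rewrite /invsqrt natrM sqrtrM ?ler0n // invfM rmorphM. Qed.

Definition dft1 (m : nat) : 'M[C]_m :=
  \matrix_(k, p) (invsqrt m * rootu m ^+ (k * p)).

Lemma dft2_tens (Nr Nc : nat) : (0 < Nr)%N -> (0 < Nc)%N ->
  dft2 R Nr Nc = dft1 Nr *t dft1 Nc.
Proof.
move=> Nr_gt0 Nc_gt0; apply/matrixP => a b; rewrite !mxE.
set k := (mxtens_unindex a).1; set l := (mxtens_unindex a).2.
set p := (mxtens_unindex b).1; set q := (mxtens_unindex b).2.
rewrite mulrACA -!cisMn -cisD -invsqrtM.
congr (_ * cis _); rewrite -[X in _ = X + _]mulr_natr -[X in _ = _ + X]mulr_natr; ring.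
Qed.

Definition dec1 (n d : nat) : 'M[R]_(n, d * n) :=
  \matrix_(a, b) ((b == a * d :> nat)%N)%:R.

Lemma decim_tens (nr nc dr dc : nat) :
  decim_mx R nr nc dr dc = dec1 nr dr *t dec1 nc dc.
Proof. by apply/matrixP => a b; rewrite !mxE -natrM mulnb. Qed.

Lemma adjmxM m n p (A : 'M[C]_(m, n)) (B : 'M[C]_(n, p)) :
  adjmx (A *m B) = adjmx B *m adjmx A.
Proof. by rewrite /adjmx trmx_mul map_mxM. Qed.

Lemma adjmxK m n (A : 'M[C]_(m, n)) : adjmx (adjmx A) = A.
Proof. by apply/matrixP => i j; rewrite !mxE conjCK. Qed.

Lemma adjmx_tens m n p q (A : 'M[C]_(m, n)) (B : 'M[C]_(p, q)) :
  adjmx (A *t B) = adjmx A *t adjmx B.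
Proof. by rewrite /adjmx trmx_tens map_mxT. Qed.

Lemma adjmx_cmx m n (A : 'M[R]_(m, n)) : adjmx (cmx A) = cmx A^T.
Proof. by apply/matrixP => i j; rewrite !mxE; apply: conjc_real. Qed.

Lemma cmxM m n p (A : 'M[R]_(m, n)) (B : 'M[R]_(n, p)) :
  cmx (A *m B) = cmx A *m cmx B.
Proof. exact: map_mxM. Qed.

Lemma cmxD m n (A B : 'M[R]_(m, n)) : cmx (A + B) = cmx A + cmx B.
Proof. exact: map_mxD. Qed.

Lemma cmxZ m n (a : R) (A : 'M[R]_(m, n)) : cmx (a *: A) = a%:C *: cmx A.
Proof. exact: map_mxZ. Qed.

Lemma cmx_sum m n (I : finType) (A : I -> 'M[R]_(m, n)) :
  cmx (\sum_j A j) = \sum_j cmx (A j).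
Proof. exact: map_mx_sum. Qed.

Lemma cmx_scalar n (a : R) : cmx (a%:M : 'M_n) = (a%:C)%:M.
Proof. exact: map_scalar_mx. Qed.

Lemma dft1_unitary m : (0 < m)%N -> dft1 m *m adjmx (dft1 m) = 1%:M.
Proof.
move=> m_gt0; apply/matrixP => k l; rewrite !mxE.
under eq_bigr do rewrite !mxE rmorphM /= mulrACA.
rewrite -mulr_sumr sum_char // !modn_small // -val_eqE.
rewrite conj_invsqrt invsqrt_sqr mulrnAr mulVf //.
by rewrite pnatr_eq0 -lt0n.
Qed.

Lemma dec1_orth n d : (0 < d)%N -> dec1 n d *m (dec1 n d)^T = 1%:M.
Proof.
move=> d_gt0; apply/matrixP => a a'; rewrite !mxE.
have lt_ad : (a * d < d * n)%N by rewrite mulnC ltn_pmul2l.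
rewrite (bigD1 (Ordinal lt_ad)) //= big1 => [|b neq_b].
  rewrite !mxE eqxx mul1r addr0 /= eqn_pmul2r //.
by rewrite !mxE -val_eqE in neq_b *; rewrite (negPf neq_b) mul0r.
Qed.

Definition decdft1 (n d : nat) : 'M[C]_(d * n, n) :=
  \matrix_(k, a) (invsqrt (d * n) * rootu n ^+ (k * a)).

(** Reading the transform of length [d n] at multiples of [d] leaves a transform
    over [n] points, because [rootu (d n) ^+ d = rootu n]. *)
Lemma decdft1E n d : (0 < d)%N ->
  decdft1 n d = dft1 (d * n) *m adjmx (cmx (dec1 n d)).
Proof.
move=> d_gt0; apply/matrixP => k a; rewrite !mxE.
have lt_ad : (a * d < d * n)%N by rewrite mulnC ltn_pmul2l.
rewrite (bigD1 (Ordinal lt_ad)) //= big1 => [|b neq_b].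
  rewrite !mxE eqxx addr0 !rmorph1 mulr1 -!cisMn; congr (_ * cis _).
  have n_gt0 : (0 < n)%N by exact: leq_ltn_trans (ltn_ord a).
  rewrite -[LHS]mulr_natr -[RHS]mulr_natr !natrM.
  by field; rewrite !pnatr_eq0 -!lt0n d_gt0 n_gt0.
rewrite !mxE -val_eqE in neq_b *; rewrite (negPf neq_b) /=.
by rewrite !rmorph0 mulr0.
Qed.

Lemma decdft1_gram n d : (0 < n)%N -> (0 < d)%N ->
  adjmx (decdft1 n d) *m decdft1 n d = 1%:M.
Proof.
move=> n_gt0 d_gt0; rewrite decdft1E // adjmxM adjmxK.
have /mulmx1C u : dft1 (d * n) *m adjmx (dft1 (d * n)) = 1%:M.
  by apply: dft1_unitary; rewrite muln_gt0 d_gt0.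
rewrite mulmxA -(mulmxA (cmx _)) u mulmx1 adjmx_cmx -map_mxM.
by rewrite dec1_orth // map_mx1.
Qed.

(** Aliasing: two frequencies of the long transform are indistinguishable after
    decimation exactly when they agree modulo [n]. *)
Lemma decdft1_cogram n d : (0 < n)%N -> (0 < d)%N ->
  decdft1 n d *m adjmx (decdft1 n d) =
  d%:R^-1 *: ((const_mx 1 : 'M_d) *t (1%:M : 'M_n)).
Proof.
move=> n_gt0 d_gt0; apply/matrixP => k l; rewrite !mxE.
under eq_bigr do rewrite !mxE rmorphM /= mulrACA.
rewrite -mulr_sumr sum_char // mul1r -val_eqE /=.
rewrite conj_invsqrt invsqrt_sqr natrM invfM -[n%:R *+ _]mulr_natr.
by rewrite mulrA mulfVK // pnatr_eq0 -lt0n.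
Qed.

End Fourier.

(** * Power spectrum and whiteness *)

Section Whiteness.
Set Implicit Arguments.
Unset Strict Implicit.
Context {R : realType}.
Local Notation C := R[i].
Local Notation normc := Normc.normc.

Lemma sqr_normcE (x : C) : (normc x ^+ 2)%:C = x * Num.conj x.
Proof. by rewrite rmorphXn -normCK. Qed.

Lemma normc_conj (x : C) : normc (Num.conj x) = normc x.
Proof. by apply: complexI; exact: norm_conjC. Qed.

Lemma normc_real (t : R) : normc t%:C = `|t|.
Proof. by rewrite /= expr0n /= addr0 sqrtr_sqr. Qed.

Lemma parseval m n (A : 'M[C]_(m, n)) (x : 'cV[C]_n) :
  adjmx A *m A = 1%:M ->
  \sum_k normc ((A *m x) k ord0) ^+ 2 = \sum_a normc (x a ord0) ^+ 2.
Proof.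
move=> A1; apply: complexI; rewrite !rmorph_sum /=.
have E p (y : 'cV[C]_p) : \sum_k (normc (y k ord0) ^+ 2)%:C = (adjmx y *m y) ord0 ord0.
  by rewrite mxE; apply: eq_bigr => k _; rewrite sqr_normcE !mxE mulrC.
by rewrite !E adjmxM mulmxA -(mulmxA (adjmx x)) A1 mulmx1.
Qed.

(** Wiener-Khinchin on a finite group, with the character [chi] fixed: substitute
    [q := add p q] in one factor and use [chi (add p q) / chi p = chi q].
    Realness of [e] lets the auto-correlation be taken without a conjugate. *)
Lemma wiener_khinchin (G : finType) (add : G -> G -> G) (chi e : G -> C) :
  (forall p, injective (add p)) ->
  (forall p q, chi (add p q) = chi p * chi q) ->
  (forall p, chi p * Num.conj (chi p) = 1) ->
  (forall p, Num.conj (e p) = e p) ->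
  (\sum_p e p * chi p) * Num.conj (\sum_p e p * chi p) =
  \sum_q (\sum_p e p * e (add p q)) * chi q.
Proof.
move=> add_inj chiM chi1 e_real; rewrite rmorph_sum /= mulrC.
under [RHS]eq_bigr do rewrite mulr_suml.
rewrite exchange_big mulr_suml; apply: eq_bigr => p _ /=.
rewrite (reindex_inj (add_inj p)) mulr_sumr; apply: eq_bigr => q _.
by rewrite rmorphM /= e_real chiM -[chi q in RHS]mul1r -(chi1 p); ring.
Qed.

Lemma tens_idmx m n : (1%:M : 'M[C]_m) *t (1%:M : 'M[C]_n) = 1%:M.
Proof.
apply/matrixP => i j; rewrite !mxE -natrM mulnb.
by rewrite -(inj_eq (can_inj (@mxtens_unindexK m n))).
Qed.

Lemma sum_mxtens (V : nmodType) m n (f : 'I_(m * n) -> V) :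
  \sum_a f a = \sum_(p : 'I_m * 'I_n) f (mxtens_index p).
Proof.
apply: reindex; exists (@mxtens_unindex m n) => p _.
  exact: mxtens_indexK.
exact: mxtens_unindexK.
Qed.

Variables (nr nc dr dc : nat).
Hypotheses (nr_gt0 : (0 < nr)%N) (nc_gt0 : (0 < nc)%N).
Hypotheses (dr_gt0 : (0 < dr)%N) (dc_gt0 : (0 < dc)%N).
Local Notation N := (dr * nr * (dc * nc))%N.

(** Locked, since otherwise rewriting with associativity of the matrix product
    opens it up. *)
Fact decdft_key : unit. Proof. exact: tt. Qed.
Definition decdft : 'M[C]_(N, nr * nc) := locked_with decdft_key
  (dft2 R (dr * nr) (dc * nc) *m adjmx (cmx (decim_mx R nr nc dr dc))).

Lemma decdftE :
  decdft = dft2 R (dr * nr) (dc * nc) *m adjmx (cmx (decim_mx R nr nc dr dc)).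
Proof. exact: unlock. Qed.

Lemma decdft_tens : decdft = decdft1 nr dr *t decdft1 nc dc.
Proof.
rewrite decdftE dft2_tens ?muln_gt0 ?dr_gt0 ?dc_gt0 // decim_tens.
by rewrite /cmx map_mxT adjmx_tens tensmx_mul !decdft1E.
Qed.

(** The transform of a zero-interpolated image has the norm of the image. *)
Lemma decdft_gram : adjmx decdft *m decdft = 1%:M.
Proof. by rewrite decdft_tens adjmx_tens tensmx_mul !decdft1_gram // tens_idmx. Qed.

Lemma decdft_cogram :
  decdft *m adjmx decdft = (dr * dc)%:R^-1 *: cmx (alias_mx R nr nc dr dc).
Proof.
rewrite decdft_tens adjmx_tens tensmx_mul !decdft1_cogram //.
apply/matrixP => a b; rewrite !mxE !mul1r -!natrM natrM invfM mulrACA.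
by rewrite -!natrM rmorph_nat.
Qed.

Lemma dft2_unitary : 
  dft2 R (dr * nr) (dc * nc) *m adjmx (dft2 R (dr * nr) (dc * nc)) = 1%:M.
Proof.
rewrite dft2_tens ?muln_gt0 ?dr_gt0 ?dc_gt0 // adjmx_tens tensmx_mul.
by rewrite !dft1_unitary ?muln_gt0 ?dr_gt0 ?dc_gt0 // tens_idmx.
Qed.

Definition image_vec (e : 'M[C]_(nr, nc)) : 'cV[C]_(nr * nc) :=
  \col_a e (mxtens_unindex a).1 (mxtens_unindex a).2.

Lemma rootu_mod n k i j : (0 < n)%N ->
  rootu n ^+ (k * ((i + j) %% n)) = rootu n ^+ (k * i) * rootu n ^+ (k * j) :> C.
Proof.
move=> n_gt0; rewrite -exprD -mulnDr -(prim_expr_mod (prim_rootu n_gt0)) modnMmr.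
by rewrite (prim_expr_mod (prim_rootu n_gt0)).
Qed.

Lemma addm_ord_inj n (i : 'I_n) : injective (addm_ord i).
Proof.
move=> j k [] /eqP; rewrite eqn_modDl !modn_small // => /eqP jk.
exact: val_inj.
Qed.

(** The factor is [invsqrt N] and not [invsqrt N ^+ 2] because [decdft], on the
    right, contains one such factor already. *)
Lemma decdft_power_spectrum (x : 'cV[C]_(nr * nc)) (k : 'I_N) :
  map_mx Num.conj x = x ->
  (decdft *m x) k ord0 * Num.conj ((decdft *m x) k ord0) =
  invsqrt N * (decdft *m image_vec (autocorr (image_of x))) k ord0.
Proof.
move=> x_real.
pose chi (p : 'I_nr * 'I_nc) : C :=
  rootu nr ^+ ((mxtens_unindex k).1 * p.1) * rootu nc ^+ ((mxtens_unindex k).2 * p.2).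
pose e p := x (mxtens_index p) ord0.
have dftE y : (decdft *m y) k ord0 =
    invsqrt N * \sum_p y (mxtens_index p) ord0 * chi p.
  rewrite mxE sum_mxtens mulr_sumr; apply: eq_bigr => p _.
  rewrite decdft_tens !mxE mxtens_indexK [invsqrt (_ * (_ * _))]invsqrtM /chi.
  by ring.
rewrite !dftE rmorphM /= conj_invsqrt -/(e _).
rewrite mulrACA -mulrA; congr (_ * (_ * _)).
have wk := @wiener_khinchin _
  (fun p q => (addm_ord p.1 q.1, addm_ord p.2 q.2)) chi e.
rewrite wk.
- apply: eq_bigr => q _; rewrite !mxE mxtens_indexK; congr (_ * _).
  rewrite pair_bigA; apply: eq_bigr => p _ /=.
  by rewrite !mxE /e -surjective_pairing.
- move=> p [q1 q2] [q1' q2'] eq_add; congr (_, _).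
    by apply: (@addm_ord_inj _ p.1); apply: (congr1 fst eq_add).
  by apply: (@addm_ord_inj _ p.2); apply: (congr1 snd eq_add).
- by move=> p q; rewrite /chi /= !rootu_mod // mulrACA.
- move=> p; rewrite /chi rmorphM /= !conj_rootuX mulrACA !divff ?mulr1 //.
    by rewrite expf_neq0 ?rootu_neq0.
  by rewrite expf_neq0 ?rootu_neq0.
- by move=> p; rewrite /e -{2}x_real mxE.
Qed.

Lemma frob_sqr m n (e : 'M[C]_(m, n)) :
  frob e ^+ 2 = \sum_i \sum_j normc (e i j) ^+ 2.
Proof.
rewrite sqr_sqrtr // sumr_ge0 // => i _; rewrite sumr_ge0 // => j _.
exact: sqr_ge0.
Qed.

(** Parseval is applied to [x] for the denominator, and to its auto-correlation,
    whose transform is the power spectrum of [x], for the numerator. *)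
Lemma whiteness_decdft (x : 'cV[C]_(nr * nc)) :
  map_mx Num.conj x = x ->
  whiteness (image_of x) =
    N%:R * ((\sum_k normc ((decdft *m x) k ord0) ^+ 4) /
            (\sum_k normc ((decdft *m x) k ord0) ^+ 2) ^+ 2).
Proof.
move=> x_real; rewrite /whiteness (exprM _ 2 2) !frob_sqr mulrA; congr (_ / _ ^+ 2); last first.
  rewrite (parseval _ decdft_gram) sum_mxtens pair_bigA.
  by apply: eq_bigr => -[i j] _; rewrite mxE.
set A := autocorr _.
transitivity (\sum_a normc (image_vec A a ord0) ^+ 2).
  rewrite sum_mxtens pair_bigA.
  by apply: eq_bigr => -[i j] _; rewrite !mxE mxtens_indexK.
rewrite -(parseval _ decdft_gram) mulr_sumr; apply: eq_bigr => k _.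
have N_neq0 : N%:R != 0 :> R by rewrite pnatr_eq0 -lt0n !muln_gt0 dr_gt0 nr_gt0 dc_gt0.
set z := (decdft *m x) k ord0.
have -> : normc z ^+ 4 = normc (z * Num.conj z) ^+ 2.
  by rewrite Normc.normcM normc_conj -expr2 -exprM.
rewrite decdft_power_spectrum // Normc.normcM exprMn mulrA normc_real.
by rewrite real_normK ?num_real // exprVn sqr_sqrtr ?ler0n // mulfV // mul1r.
Qed.

End Whiteness.

(** * Regularised inversion of a sampled diagonal model

    The algebra of the solution formula, over any field.  Primed matrices stand
    for adjoints, [F] for the transform, [T] for [F] after zero interpolation,
    [G] for the sum over blocks of aliased frequencies, [A] for the penalty. *)

Section SampledModel.
Set Implicit Arguments.
Unset Strict Implicit.
Variables (K : fieldType) (N n : nat) (A B : 'M[K]_N).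
Variables (U G T' : 'M[K]_(n, N)) (V G' T : 'M[K]_(N, n)).
Variables (Lam Lam' F F' : 'M[K]_N) (m d : K).
Let D := d%:M + m *: (U *m B *m V).
Let Q := B - m *: (B *m V *m invmx D *m U *m B).
Hypotheses (AB1 : A *m B = 1%:M) (D_unit : D \in unitmx) (d_neq0 : d != 0).

(** Replacing [m U B V] by [D - d] cancels everything but the [d] term. *)
Lemma woodbury_mull : U *m Q = d *: (invmx D *m U *m B).
Proof.
have mD : m *: (U *m B *m V) = D - d%:M by rewrite /D addrC addKr.
rewrite /Q mulmxBr -scalemxAr !mulmxA -!(mulmxA (_ *m _ *m V)) scalemxAl mD.
by rewrite mulmxBl !mulmxA mulmxV // mul1mx mul_scalar_mx -!scalemxAl opprB addrC subrK.
Qed.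

Lemma woodbury_inv : (A + (m / d) *: (V *m U)) *m Q = 1%:M.
Proof.
rewrite mulmxDl -scalemxAl -mulmxA woodbury_mull -scalemxAr scalerA divfK //.
by rewrite /Q mulmxBr -scalemxAr !mulmxA AB1 mul1mx subrK.
Qed.

Hypotheses (UE : U = G *m Lam) (VE : V = Lam' *m G').
Hypotheses (TT1 : T' *m T = 1%:M) (TG : T *m T' = d^-1 *: (G' *m G)).
Hypotheses (FF1 : F *m F' = 1%:M).

(** The rank-[n] correction is the data term of the normal equations: with
    [T' Lam F = S K], the right-hand side is [m (S K)^H (S K)]. *)
Lemma sampled_normal_mxE : (m / d) *: (F' *m (V *m U) *m F) =
  m *: (F' *m Lam' *m T *m (T' *m Lam *m F)).
Proof.
have GG : G' *m G = d *: (T *m T') by rewrite TG scalerA mulfV ?scale1r.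
rewrite UE VE !mulmxA -(mulmxA _ G') GG -scalemxAr -!scalemxAl scalerA divfK //.
by rewrite !mulmxA.
Qed.

Lemma sampled_normal_unit :
  F' *m (A + (m / d) *: (V *m U)) *m F \in unitmx.
Proof.
suff /mulmx1_unit[M_unit _] :
  F' *m (A + (m / d) *: (V *m U)) *m F *m (F' *m Q *m F) = 1%:M by [].
rewrite !mulmxA -(mulmxA _ F) FF1 mulmx1 -(mulmxA _ _ Q) woodbury_inv mulmx1.
exact: mulmx1C.
Qed.

Lemma sampled_normal_eq p (g : 'M[K]_(N, p)) :
  F' *m (A + (m / d) *: (V *m U)) *m F *m (F' *m Q *m g) = F' *m g.
Proof.
by rewrite !mulmxA -(mulmxA _ F) FF1 mulmx1 -(mulmxA _ _ Q) woodbury_inv mulmx1.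
Qed.

Variables (p : nat) (b : 'M[K]_(n, p)).

(** [T b] is fixed by the projector [T T']. *)
Lemma sampled_dataE : T *m b = d^-1 *: (G' *m (G *m (T *m b))).
Proof.
by rewrite (mulmxA G') scalemxAl -TG !mulmxA -(mulmxA T) TT1 mulmx1.
Qed.

(** The data enter the left-hand side twice, through the right-hand side of the
    normal equations and through the [m]-part of [D] applied to [G T b].  Both
    contributions are [m U B V G T b], and they cancel. *)
Lemma capacitance_residual (g0 : 'M[K]_(N, p)) :
  D *m (U *m (Q *m (m *: (Lam' *m (T *m b)) + g0)) - G *m (T *m b)) =
  d *: (U *m B *m g0 - G *m (T *m b)).
Proof.
have -> : m *: (Lam' *m (T *m b)) = (m / d) *: (V *m (G *m (T *m b))).
  by rewrite {1}sampled_dataE -scalemxAr scalerA VE !mulmxA.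
set rho := G *m (T *m b).
rewrite mulmxBr (mulmxA U) woodbury_mull -scalemxAl -scalemxAr.
rewrite -!(mulmxA (invmx _)) mulKVmx // [in X in _ - X]/D mulmxDl mul_scalar_mx.
rewrite mulmxDr -scalemxAr scalerDr scalerA (mulrC d) divfK // -scalemxAl.
by rewrite !mulmxA scalerBr opprD [- _ - _]addrC addrACA subrr add0r.
Qed.

Lemma sampled_residualE (y : 'M[K]_(N, p)) :
  T *m (T' *m Lam *m y - b) = d^-1 *: (G' *m (U *m y - G *m (T *m b))).
Proof.
rewrite !mulmxBr scalerBr -sampled_dataE; congr (_ - _).
by rewrite UE !mulmxA TG -!scalemxAl.
Qed.

End SampledModel.

(** * Blocks of aliased frequencies *)

Section Blocks.
Set Implicit Arguments.
Unset Strict Implicit.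
Context {R : realType}.
Local Notation C := R[i].
Variables (nr nc dr dc : nat).
Hypotheses (nr_gt0 : (0 < nr)%N) (nc_gt0 : (0 < nc)%N).
Hypotheses (dr_gt0 : (0 < dr)%N) (dc_gt0 : (0 < dc)%N).
Local Notation N := (dr * nr * (dc * nc))%N.
Local Notation n := (nr * nc)%N.
Local Notation d := (dr * dc)%N.

Lemma block_ltn (k : 'I_N) : (k %/ d < n)%N.
Proof. by rewrite ltn_divLR ?muln_gt0 ?dr_gt0 // [ltnRHS]block_size. Qed.

Definition block_of (k : 'I_N) : 'I_n := Ordinal (block_ltn k).

Lemma block_ones_colE k m :
  block_ones_col R nr nc dr dc k m = (block_of k == m)%:R.
Proof.
rewrite castmxE !mxE mulr1 -val_eqE /=.
by rewrite divn1.
Qed.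

Lemma block_ones_mxE : block_ones_mx R nr nc dr dc =
  block_ones_col R nr nc dr dc *m (block_ones_col R nr nc dr dc)^T.
Proof.
apply/matrixP => k l; rewrite castmxE !mxE (bigD1 (block_of k)) //= big1 => [|m neq_m].
  rewrite mxE !block_ones_colE eqxx mul1r mulr1 addr0 -val_eqE /= eq_sym.
  by rewrite -val_eqE.
by rewrite block_ones_colE eq_sym (negPf neq_m) mul0r.
Qed.

Lemma sum_block (V : nmodType) (f : 'I_N -> V) i :
  \sum_(k | block_of k == block_of i) f k = \sum_(l < d) f (block_idx i l).
Proof.
have d_gt0 : (0 < d)%N by rewrite muln_gt0 dr_gt0.
rewrite (reindex_onto (block_idx i) (fun k : 'I_N => Ordinal (ltn_pmod k d_gt0))) /=.
  apply: eq_bigl => l; rewrite -!val_eqE /= divnMDl // (divn_small (ltn_ord l)) addn0 eqxx /=.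
  by rewrite modnMDl modn_small // eqxx.
move=> k /eqP/(congr1 val)/= ki; apply: val_inj => /=.
by rewrite -ki -divn_eq.
Qed.

Definition diagf (f : 'I_N -> C) : 'M[C]_N := diag_mx (\row_k f k).

Lemma diagfE f p (A : 'M[C]_(N, p)) k j : (diagf f *m A) k j = f k * A k j.
Proof. by rewrite mul_diag_mx !mxE. Qed.

Lemma diagfM f g : diagf f *m diagf g = diagf (fun k => f k * g k).
Proof.
by rewrite /diagf mulmx_diag; congr diag_mx; apply/rowP => k; rewrite !mxE.
Qed.

Lemma eq_diagf f g : f =1 g -> diagf f = diagf g.
Proof. by move=> fg; congr diag_mx; apply/rowP => k; rewrite !mxE. Qed.

Lemma adj_diagf f : adjmx (diagf f) = diagf (fun k => Num.conj (f k)).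
Proof.
apply/matrixP => k l; rewrite !mxE eq_sym; case: eqVneq => [->|_] //=.
by rewrite !mulr0n rmorph0.
Qed.

Local Notation E := (cmx (block_ones_col R nr nc dr dc)).

Lemma block_sumE p (A : 'M[C]_(N, p)) i j :
  (E^T *m A) (block_of i) j = \sum_(l < d) A (block_idx i l) j.
Proof.
rewrite mxE -(sum_block (fun k => A k j)) [RHS]big_mkcond; apply: eq_bigr => k _.
by rewrite !mxE block_ones_colE; case: eqP => _; rewrite ?rmorph1 ?rmorph0 ?mul1r ?mul0r.
Qed.

Lemma block_copyE p (A : 'M[C]_(n, p)) i j : (E *m A) i j = A (block_of i) j.
Proof.
rewrite mxE (bigD1 (block_of i)) //= big1 => [|m neq_m].
  by rewrite mxE block_ones_colE eqxx rmorph1 mul1r addr0.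
by rewrite mxE block_ones_colE eq_sym (negPf neq_m) rmorph0 mul0r.
Qed.

Lemma block_of_onto m : exists i, block_of i = m.
Proof.
have d_gt0 : (0 < d)%N by rewrite muln_gt0 dr_gt0.
have lt_md : (m * d < N)%N by rewrite -block_size ltn_pmul2r.
by exists (Ordinal lt_md); apply: val_inj; rewrite /= mulnK.
Qed.

(** Compressing a diagonal matrix to block-constant vectors gives the diagonal
    matrix of the block sums. *)
Lemma block_gramE (w : 'I_N -> C) p (A : 'M[C]_(n, p)) i j :
  (E^T *m diagf w *m E *m A) (block_of i) j =
  (\sum_(l < d) w (block_idx i l)) * A (block_of i) j.
Proof.
rewrite -!mulmxA block_sumE mulr_suml; apply: eq_bigr => l _.
rewrite diagfE block_copyE; congr (_ * A _ _); apply: val_inj => /=.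
by rewrite divnMDl ?muln_gt0 ?dr_gt0 // (divn_small (ltn_ord l)) addn0.
Qed.

End Blocks.

(** * Conjugation by the permutation *)

Section Permuted.
Set Implicit Arguments.
Unset Strict Implicit.
Context {R : realType}.
Local Notation C := R[i].
Variables (N : nat) (P : 'M[R]_N).
Hypothesis P_perm : is_perm_mx P.

Lemma perm_mx_orth : cmx P *m cmx P^T = 1%:M.
Proof.
case/is_perm_mxP: P_perm => s ->.
by rewrite -map_mxM tr_perm_mx -perm_mxM mulgV perm_mx1 map_mx1.
Qed.

Definition hat (X : 'M[C]_N) : 'M[C]_N := cmx P *m X *m cmx P^T.

Lemma hatM X Y : hat X *m hat Y = hat (X *m Y).
Proof.
rewrite /hat !mulmxA -(mulmxA (_ *m X)).
by rewrite (mulmx1C perm_mx_orth) mulmx1.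
Qed.

Lemma hatK X : cmx P^T *m hat X *m cmx P = X.
Proof.
rewrite /hat !mulmxA (mulmx1C perm_mx_orth) mul1mx -mulmxA.
by rewrite (mulmx1C perm_mx_orth) mulmx1.
Qed.

Lemma hat1 : hat 1%:M = 1%:M.
Proof. by rewrite /hat mulmx1 perm_mx_orth. Qed.

Lemma hat_adj X : hat (adjmx X) = adjmx (hat X).
Proof. by rewrite /hat !adjmxM !adjmx_cmx trmxK mulmxA. Qed.

Lemma sum_perm_mx (x : 'cV[C]_N) (f : C -> R) :
  \sum_k f ((cmx P *m x) k ord0) = \sum_k f (x k ord0).
Proof.
case/is_perm_mxP: P_perm => s ->.
rewrite /cmx map_perm_mx -row_permE [RHS](reindex_perm s) /=.
by apply: eq_bigr => k _; rewrite mxE.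
Qed.

Lemma perm_mx_cancel m p (X : 'M[C]_(m, N)) (Y : 'M[C]_(N, p)) :
  X *m cmx P *m (cmx P^T *m Y) = X *m Y.
Proof. by rewrite mulmxA -(mulmxA X) perm_mx_orth mulmx1. Qed.

Lemma perm_mulK p (Y : 'M[C]_(N, p)) : cmx P *m (cmx P^T *m Y) = Y.
Proof. by rewrite mulmxA perm_mx_orth mul1mx. Qed.

Lemma hat_inv X Y : hat X = Y -> X = cmx P^T *m (Y *m cmx P).
Proof. by move=> <-; rewrite mulmxA hatK. Qed.

End Permuted.

(** * The residual in the permuted Fourier basis *)

Section Residual.
Set Implicit Arguments.
Unset Strict Implicit.
Context {R : realType}.
Local Notation C := R[i].
Variables (nr nc dr dc s : nat).
Hypotheses (nr_gt0 : (0 < nr)%N) (nc_gt0 : (0 < nc)%N).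
Hypotheses (dr_gt0 : (0 < dr)%N) (dc_gt0 : (0 < dc)%N).
Local Notation N := (dr * nr * (dc * nc))%N.
Local Notation n := (nr * nc)%N.
Local Notation d := (dr * dc)%N.

Lemma scaleB_mxE m p (c : C) (A B : 'M[C]_(m, p)) i j :
  (c *: (A - B)) i j = c * (A i j - B i j).
Proof. by rewrite !mxE. Qed.

Lemma hat_diagE (P : 'M[R]_N) (X : 'M[C]_N) : is_perm_mx P -> is_diag_mx X ->
  hat P X = diagf (hat_diag P X).
Proof.
case/is_perm_mxP => t -> /is_diag_mxP X_diag; apply/matrixP => k l.
have -> : diagf (hat_diag (perm_mx t) X) k l = hat_diag (perm_mx t) X k *+ (k == l).
  by rewrite mxE [X in X *+ _]mxE.
case: eqVneq => [->//|neq_kl].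
rewrite mulr0n; have -> : hat (perm_mx t) X k l = X (t k) (t l).
  rewrite /hat /cmx tr_perm_mx !map_perm_mx -row_permE -[t in LHS]invgK.
  by rewrite -col_permE !mxE !invgK.
by apply: X_diag; rewrite (inj_eq val_inj) (inj_eq perm_inj).
Qed.

Variables (P : 'M[R]_N) (Lam : 'M[C]_N) (Gam : 'I_s -> 'M[C]_N) (eps mu : R).
Hypotheses (P_perm : is_perm_mx P) (Lam_diag : is_diag_mx Lam).
Hypothesis (Gam_diag : forall j, is_diag_mx (Gam j)).
Hypotheses (eps_gt0 : 0 < eps) (mu_gt0 : 0 < mu).
Local Notation lamh := (hat_diag P Lam).
Local Notation gamh := (fun j => hat_diag P (Gam j)).
Local Notation E := (cmx (block_ones_col R nr nc dr dc)).
Local Notation cP := (cmx P).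
Local Notation U := (uLam P Lam).
Local Notation V := (uLamH P Lam).
Local Notation Ps := (Psi Gam eps).

Definition penalty : 'M[C]_N := \sum_j adjmx (Gam j) *m Gam j + (eps%:C)%:M.

Lemma zeta_ge0 k : 0 <= zeta_par gamh k.
Proof. by rewrite sumr_ge0 // => j _; rewrite sqr_ge0. Qed.

Lemma eta_ge0 i : 0 <= eta_par eps lamh gamh i.
Proof.
rewrite mulr_ge0 ?invr_ge0 ?ler0n // sumr_ge0 // => l _.
by rewrite mulr_ge0 ?sqr_ge0 // invr_ge0 addr_ge0 ?zeta_ge0 // ltW.
Qed.

Lemma hat_penalty : hat P penalty = diagf (fun k => (zeta_par gamh k + eps)%:C).
Proof.
rewrite /penalty /hat mulmxDr mulmxDl mulmx_sumr mulmx_suml.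
rewrite scalar_mxC -mulmxA perm_mx_orth // mulmx1.
under eq_bigr => j _ do
  rewrite -/(hat P _) -hatM // hat_adj // hat_diagE // adj_diagf diagfM.
apply/matrixP => k l; rewrite !mxE summxE rmorphD rmorph_sum /=.
rewrite mulrnDl -sumrMnl; congr (_ + _); apply: eq_bigr => j _.
by rewrite !mxE sqr_normcE mulrC.
Qed.

Lemma penalty_inv : penalty *m Ps = 1%:M.
Proof.
apply: mulmxV; have w_neq0 k : (zeta_par gamh k + eps)%:C != 0 :> C.
  by rewrite fmorph_eq0 gt_eqF // ltr_wpDl // zeta_ge0.
suff /mulmx1_unit[pen_unit _] : penalty *m
    (cmx P^T *m diagf (fun k => ((zeta_par gamh k + eps)%:C)^-1) *m cP) = 1%:M.
  exact: pen_unit.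
rewrite -[penalty](hatK P_perm) hat_penalty.
rewrite -!mulmxA (mulmxA cP) perm_mx_orth // mul1mx (mulmxA (diagf _)) diagfM.
rewrite (_ : diagf _ = 1%:M) ?mul1mx ?(mulmx1C (perm_mx_orth P_perm)) //.
by apply/matrixP => k l; rewrite !mxE mulfV.
Qed.

Lemma PsiE :
  Ps = cmx P^T *m (diagf (fun k => ((zeta_par gamh k + eps)%:C)^-1) *m cP).
Proof.
apply: hat_inv => //.
have := congr1 (hat P) penalty_inv; rewrite -hatM // hat1 // hat_penalty.
move=> /(congr1 (mulmx (diagf (fun k => ((zeta_par gamh k + eps)%:C)^-1)))).
rewrite mulmxA mulmx1 diagfM (_ : diagf _ = 1%:M) ?mul1mx //.
apply/matrixP => k l; rewrite !mxE mulVf //.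
by rewrite fmorph_eq0 gt_eqF // ltr_wpDl // zeta_ge0.
Qed.

Lemma LamE : Lam = cmx P^T *m (diagf lamh *m cP).
Proof. by apply: hat_inv => //; apply: hat_diagE. Qed.

Lemma uLamE : U = E^T *m diagf lamh *m cP.
Proof.
by rewrite /uLam {1}LamE perm_mx_cancel // mulmxA /cmx map_trmx.
Qed.

Lemma uLamHE : V = cmx P^T *m (diagf (fun k => Num.conj (lamh k)) *m E).
Proof.
have -> : V = adjmx (E^T *m cP *m Lam).
  by rewrite !adjmxM /cmx map_trmx !adjmx_cmx trmxK /uLamH mulmxA.
rewrite {1}LamE perm_mx_cancel // !adjmxM adj_diagf.
by rewrite /cmx map_trmx !adjmx_cmx trmxK -mulmxA.
Qed.

Local Notation D := (d%:R%:M + mu%:C *: (U *m Ps *m V)).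

(** [U Psi U^H] is the compression to blocks of the diagonal matrix with entries
    [|lamh|^2 / (zeta + eps)], whose block sums are [d eta]. *)
Lemma capacitanceE p (A : 'M[C]_(n, p)) i j :
  (D *m A) (block_of dr_gt0 dc_gt0 i) j =
  (d%:R * (1 + eta_par eps lamh gamh i * mu))%:C
    * A (block_of dr_gt0 dc_gt0 i) j.
Proof.
have -> : U *m Ps *m V =
    E^T *m diagf (fun k => (Normc.normc (lamh k) ^+ 2 / (zeta_par gamh k + eps))%:C) *m E.
  rewrite uLamE PsiE perm_mx_cancel // uLamHE (mulmxA (E^T *m _)) perm_mx_cancel //.
  rewrite mulmxA -(mulmxA E^T (diagf _)) diagfM -(mulmxA E^T (diagf _)) diagfM.
  congr (_ *m _ *m _); apply: eq_diagf => k.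
  by rewrite mulrAC -sqr_normcE -fmorphV -rmorphM.
rewrite mulmxDl mul_scalar_mx -scalemxAl [LHS]mxE [X in X + _]mxE [X in _ + X]mxE.
rewrite block_gramE.
rewrite mulrA -mulrDl; congr (_ * _).
rewrite /eta_par -rmorph_sum mulrDr mulr1 rmorphD rmorph_nat; congr (_ + _).
rewrite -rmorphM; congr (_%:C); rewrite [RHS]mulrA mulVKf 1?mulrC //.
by rewrite pnatr_eq0 -lt0n muln_gt0 dr_gt0.
Qed.

Lemma eta_den_gt0 i : 0 < 1 + eta_par eps lamh gamh i * mu.
Proof. by rewrite ltr_pwDl // mulr_ge0 ?eta_ge0 // ltW. Qed.

(** [D] is diagonal, so its inverse is found entrywise; the zeros off the diagonal
    are harmless as [0^-1 = 0]. *)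
Lemma capacitance_unit : D \in unitmx.
Proof.
suff /mulmx1_unit[D_unit _] : D *m map_mx GRing.inv D = 1%:M by exact: D_unit.
apply/matrixP => m j; have [i <-] := block_of_onto dr_gt0 dc_gt0 m.
have := capacitanceE 1%:M i j; rewrite mulmx1 capacitanceE !mxE => ->.
case: eqP => _; last by rewrite mulr0 invr0 mulr0.
rewrite mulr1 mulfV // fmorph_eq0 gt_eqF // mulr_gt0 ?eta_den_gt0 //.
by rewrite ltr0n muln_gt0 dr_gt0.
Qed.

Lemma nu_parE (vh : 'I_s -> 'cV[C]_N) (vt : 'I_s -> 'cV[C]_N) i :
  (forall j, vh j = cP *m vt j) ->
  (U *m Ps *m \sum_j adjmx (Gam j) *m vt j)
     (block_of dr_gt0 dc_gt0 i) ord0 = nu_par eps lamh gamh vh i.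
Proof.
move=> vhE; have -> : \sum_j adjmx (Gam j) *m vt j =
    cmx P^T *m \sum_j diagf (fun k => Num.conj (gamh j k)) *m vh j.
  rewrite mulmx_sumr; apply: eq_bigr => j _.
  rewrite vhE [in LHS](hat_inv P_perm (hat_diagE P_perm (Gam_diag j))).
  rewrite !adjmxM adj_diagf !adjmx_cmx trmxK.
  by rewrite -!mulmxA.
rewrite uLamE PsiE perm_mx_cancel // (mulmxA (E^T *m _)) perm_mx_cancel //.
rewrite -!mulmxA block_sumE; apply: eq_bigr => l _.
rewrite !diagfE mulrCA [RHS]mulrC summxE; congr (_ * (_ * _)).
by apply: eq_bigr => j _; rewrite diagfE.
Qed.


Variables (K : 'M[R]_N) (L : 'I_s -> 'M[R]_N).
Local Notation F := (dft2 R (dr * nr) (dc * nc)).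
Local Notation S := (decim_mx R nr nc dr dc).
Local Notation T := (@decdft R nr nc dr dc).
Hypothesis K_fact : cmx K = adjmx F *m Lam *m F.
Hypothesis L_fact : forall j, cmx (L j) = adjmx F *m Gam j *m F.
Hypothesis P_alias :
  P *m alias_mx R nr nc dr dc *m P^T = block_ones_mx R nr nc dr dc.

Lemma decdft_cogram_perm :
  T *m adjmx T = d%:R^-1 *: (cmx P^T *m E *m (E^T *m cP)).
Proof.
rewrite decdft_cogram // -[X in _ *: X](hatK P_perm) /hat -!cmxM P_alias.
by rewrite block_ones_mxE // !cmxM /cmx map_trmx !mulmxA.
Qed.

Lemma decim_adj_dft : cmx S *m adjmx F = adjmx T.
Proof. by rewrite decdftE adjmxM adjmxK. Qed.

(** Blurring and decimating a spatial image is a diagonal filter followed by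
    [T^H] in the Fourier domain. *)
Lemma decim_convE : cmx (S *m K) = adjmx T *m Lam *m F.
Proof. by rewrite cmxM K_fact !mulmxA decim_adj_dft. Qed.

Local Notation G := (E^T *m cP).
Local Notation G' := (cmx P^T *m E).

Lemma uLam_factor : U = G *m Lam.
Proof. by rewrite /uLam /cmx map_trmx. Qed.

Lemma uLamH_factor : V = adjmx Lam *m G'.
Proof. by rewrite /uLamH mulmxA. Qed.

Lemma block_size_neq0 : (d%:R : C) != 0.
Proof. by rewrite pnatr_eq0 -lt0n muln_gt0 dr_gt0. Qed.

Lemma dft_unitary : F *m adjmx F = 1%:M.
Proof. exact: dft2_unitary. Qed.

Lemma dft_decim_isometry : adjmx T *m T = 1%:M.
Proof. exact: decdft_gram. Qed.

Lemma dft_mulVK p (A : 'M[C]_(N, p)) : F *m (adjmx F *m A) = A.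
Proof. by rewrite mulmxA dft_unitary mul1mx. Qed.

(** The Hessian of the least squares problem, with the [eps] of [Psi] added. *)
Definition normal_mx : 'M[R]_N :=
  \sum_j (L j)^T *m L j + eps%:M + mu *: ((S *m K)^T *m (S *m K)).

Lemma normal_mxE :
  cmx normal_mx = adjmx F *m (penalty + (mu%:C / d%:R) *: (V *m U)) *m F.
Proof.
have FF : adjmx F *m F = 1%:M by apply: mulmx1C; apply: dft2_unitary.
rewrite mulmxDr mulmxDl -[X in _ + X *m _]scalemxAr -[X in _ + X]scalemxAl.
rewrite (sampled_normal_mxE _ _ _ block_size_neq0 uLam_factor uLamH_factor decdft_cogram_perm).
have -> : adjmx F *m adjmx Lam *m T = adjmx (cmx (S *m K)).
  by rewrite decim_convE !adjmxM adjmxK mulmxA.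
rewrite -decim_convE adjmx_cmx -cmxM /penalty mulmxDr mulmxDl.
rewrite mul_mx_scalar -scalemxAl FF scale_scalar_mx mulr1.
rewrite /normal_mx !cmxD cmxZ cmx_scalar; congr (_ + _ + _).
rewrite cmx_sum mulmx_sumr mulmx_suml; apply: eq_bigr => j _.
rewrite cmxM -adjmx_cmx L_fact !adjmxM adjmxK.
by rewrite -!mulmxA dft_mulVK.
Qed.

Variables (b : 'cV[R]_n) (v : 'I_s -> 'cV[R]_N).

Local Notation Q :=
  (Ps - mu%:C *: (Ps *m V *m invmx D *m U *m Ps)).
Local Notation x := (tikhonov_sol P Lam Gam b v eps mu).
Local Notation r := (residual K b x).
Local Notation g0 := (\sum_j adjmx (Gam j) *m (F *m cmx (v j))).
Local Notation g := (mu%:C *: (adjmx Lam *m (T *m cmx b)) + g0).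

Lemma tikhonov_solE : x = adjmx F *m Q *m g.
Proof. by rewrite decdftE -(mulmxA F). Qed.

(** The point of this formula is that all matrices on the right are real. *)
Lemma tikhonov_normal_eq : x =
  cmx (invmx normal_mx *m (mu *: ((S *m K)^T *m b) + \sum_j (L j)^T *m v j)).
Proof.
have M_unit := sampled_normal_unit penalty_inv capacitance_unit block_size_neq0 dft_unitary.
rewrite -normal_mxE in M_unit.
rewrite cmxM {1}/cmx map_invmx -/(cmx _); apply: (canRL (mulKmx M_unit)).
rewrite tikhonov_solE normal_mxE.
rewrite (sampled_normal_eq penalty_inv capacitance_unit block_size_neq0 dft_unitary).
have dataE : adjmx F *m (adjmx Lam *m (T *m cmx b)) = cmx ((S *m K)^T *m b).
  by rewrite cmxM -adjmx_cmx decim_convE !adjmxM adjmxK !mulmxA.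
have priorE j : adjmx F *m (adjmx (Gam j) *m (F *m cmx (v j))) = cmx ((L j)^T *m v j).
  by rewrite cmxM -adjmx_cmx L_fact !adjmxM adjmxK !mulmxA.
rewrite mulmxDr -scalemxAr dataE mulmx_sumr (eq_bigr _ (fun j _ => priorE j)).
by rewrite cmxD cmxZ cmx_sum.
Qed.

Lemma residual_real : map_mx Num.conj r = r.
Proof.
rewrite /residual tikhonov_normal_eq -!cmxM -map_mxB.
by apply/matrixP => i j; rewrite !mxE; apply: conjc_real.
Qed.

Local Notation bh := (cP *m (F *m (adjmx (cmx S) *m cmx b))).
Local Notation vh := (fun j => cP *m (F *m cmx (v j))).
Local Notation block := (block_of dr_gt0 dc_gt0).

Lemma rho_parE i : (G *m (T *m cmx b)) (block i) ord0 = rho_par bh i.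
Proof. by rewrite -mulmxA block_sumE decdftE -(mulmxA F). Qed.

Local Notation X := (U *m (Q *m g) - G *m (T *m cmx b)).

Lemma perm_dft_residualE : cP *m (T *m r) = d%:R^-1 *: (E *m X).
Proof.
have step Y : cP *m (d%:R^-1 *: (G' *m Y)) = d%:R^-1 *: (E *m Y) :> 'cV_N.
  by rewrite -scalemxAr -(mulmxA (cmx P^T)) perm_mulK.
have -> : r = adjmx T *m Lam *m (Q *m g) - cmx b.
  by rewrite /residual tikhonov_solE -cmxM decim_convE -(mulmxA (adjmx F)) -mulmxA dft_mulVK.
by rewrite (sampled_residualE uLam_factor dft_decim_isometry decdft_cogram_perm) step.
Qed.

(** Dividing [capacitance_residual] by the diagonal entries of [D]. *)
Lemma block_residual i : X (block i) ord0 =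
  (nu_par eps lamh gamh vh i - rho_par bh i) / (1 + eta_par eps lamh gamh i * mu)%:C.
Proof.
have nz : (1 + eta_par eps lamh gamh i * mu)%:C != 0 :> C.
  by rewrite fmorph_eq0 gt_eqF // eta_den_gt0.
have eqX := capacitance_residual capacitance_unit block_size_neq0 uLamH_factor dft_decim_isometry
  decdft_cogram_perm (cmx b) g0.
have entry := congr1 (fun A : 'cV[C]_n => A (block i) ord0) eqX.
apply: (canRL (mulfK nz)); apply: (mulfI block_size_neq0).
rewrite /= capacitanceE scaleB_mxE (@nu_parE vh) // rho_parE in entry.
have natMC (y : R) : (d%:R * y)%:C = d%:R * y%:C :> C by rewrite rmorphM rmorph_nat.
by rewrite -entry natMC -[RHS]mulrA [in RHS](mulrC _%:C).
Qed.

Lemma perm_dft_residual i : (cP *m (T *m r)) i ord0 =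
  d%:R^-1 * ((nu_par eps lamh gamh vh i - rho_par bh i) /
             (1 + eta_par eps lamh gamh i * mu)%:C).
Proof. by rewrite perm_dft_residualE mxE block_copyE block_residual. Qed.

End Residual.

Theorem proposition6 (R : realType) (nr nc dr dc s : nat)
    (nr_gt0 : (0 < nr)%N) (nc_gt0 : (0 < nc)%N)
    (dr_gt0 : (0 < dr)%N) (dc_gt0 : (0 < dc)%N) (s_gt0 : (0 < s)%N)
    (K : 'M[R]_(dr * nr * (dc * nc)))
    (L : 'I_s -> 'M[R]_(dr * nr * (dc * nc)))
    (Lam : 'M[R[i]]_(dr * nr * (dc * nc)))
    (Gam : 'I_s -> 'M[R[i]]_(dr * nr * (dc * nc)))
    (P : 'M[R]_(dr * nr * (dc * nc)))
    (b : 'cV[R]_(nr * nc)) (v : 'I_s -> 'cV[R]_(dr * nr * (dc * nc)))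
    (eps mu : R) :
  let F := dft2 R (dr * nr) (dc * nc) in
  let bH := adjmx (cmx (decim_mx R nr nc dr dc)) *m cmx b in
  let bh := cmx P *m (F *m bH) in
  let vh := fun j => cmx P *m (F *m cmx (v j)) in
  let lamh := hat_diag P Lam in
  let gamh := fun j => hat_diag P (Gam j) in
  let r := residual K b (tikhonov_sol P Lam Gam b v eps mu) in
  let term := fun i =>
    Normc.normc ((nu_par eps lamh gamh vh i - rho_par bh i)
                 / (1 + eta_par eps lamh gamh i * mu)%:C) in
  is_conv2 K -> (forall j, is_conv2 (L j)) ->
  is_diag_mx Lam -> (forall j, is_diag_mx (Gam j)) ->
  cmx K = adjmx F *m Lam *m F ->
  (forall j, cmx (L j) = adjmx F *m Gam j *m F) ->
  is_perm_mx P ->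
  P *m alias_mx R nr nc dr dc *m P^T = block_ones_mx R nr nc dr dc ->
  0 < eps -> 0 < mu -> r != 0 ->
  (forall i, 0 <= eta_par eps lamh gamh i) /\
  whiteness (image_of r) =
    (dr * nr * (dc * nc))%:R *
    ((\sum_i term i ^+ 4) / (\sum_i term i ^+ 2) ^+ 2).
Proof.
move=> F bH bh vh lamh gamh r term _ _ Lam_diag Gam_diag K_fact L_fact P_perm P_alias
  eps_gt0 mu_gt0 _; split=> [i|]; first exact: eta_ge0.
have r_real : map_mx Num.conj r = r by apply: (@residual_real _ nr nc dr dc s) L_fact _ _ _.
rewrite (whiteness_decdft nr_gt0 nc_gt0 dr_gt0 dc_gt0 r_real); congr (_ * _).
(* Reindexing by the permutation leaves the sums unchanged. *)
have termE k : \sum_i Normc.normc ((decdft nr nc dr dc *m r) i ord0) ^+ k =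
    (dr * dc)%:R^-1 ^+ k * \sum_i term i ^+ k.
  rewrite -(sum_perm_mx P_perm _ (fun z => Normc.normc z ^+ k)) mulr_sumr.
  apply: eq_bigr => i _.
  rewrite (perm_dft_residual nr_gt0 nc_gt0 dr_gt0 dc_gt0 P_perm Lam_diag Gam_diag eps_gt0 mu_gt0) //.
  rewrite Normc.normcM exprMn -[X in Normc.normc X^-1](rmorph_nat (real_complex R)).
  by rewrite -fmorphV normc_real ger0_norm ?invr_ge0 ?ler0n.
rewrite !termE exprMn -exprM -mulf_div divff ?mul1r //.
by rewrite expf_neq0 // invr_eq0 pnatr_eq0 -lt0n muln_gt0 dr_gt0.
Qed.
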